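(* For every positive integer $k \le 4 \cdot 10^{58}$, the equation $\phi(n+k) = 2\,\phi(n)$ has at least three distinct solutions $n$ in positive integers.
   Context: $\phi$ denotes Euler's Phi function: $\phi(n)$ is the number of positive integers less than or equal to $n$ that are coprime with $n$. Here $k$ is fixed and $n$ is the unknown. *)

(* Defs.v *)
From mathcomp Require Import all_boot.

(* Main.v *)
Require Import Defs.
From Stdlib Require Import NArith.
From mathcomp Require Import all_boot zify.

(** Let [b = a + c], and let [T] be a set of primes dividing [a * b]. If [c] divides [k] and,
    with [m = k / c], the primes dividing [a * b] but not [m] are exactly those of [T], then
    [totient (m * b) / totient (m * a)] is a rational number determined by [a], [b] and [T].
    When it equals [2], the number [n = m * a] is a solution, since [n + k = m * b]. There are
    135 such patterns [(T, a, b, c)] for which an exhaustive case distinction on the prime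
    powers dividing [k] shows that three of them apply to [k] and give distinct solutions,
    unless [k] is divisible by a number larger than [4 * 10 ^ 58]. *)

(** * Totients of products with listed primes *)

Lemma totient_prime_mul p m :
  prime p -> 0 < m -> totient (p * m) = (if p %| m then p else p.-1) * totient m.
Proof.
move=> p_pr m_gt0; have [m' co_pm' ->] := pfactor_coprime p_pr m_gt0.
have co e : coprime m' (p ^ e) by rewrite coprime_sym coprimeXl.
rewrite mulnCA -expnS !totient_coprime //.
case: (logn p m) => [|e].
  move: co_pm'; rewrite prime_coprime // expn0 expn1 muln1 => /negbTE->.
  by rewrite (totient_prime p_pr) mulnCA muln1 mulnC.
rewrite !totient_pfactor //= expnS dvdn_mull ?dvdn_mulr //.
by rewrite [RHS]mulnCA (mulnCA p).
Qed.

Lemma prod_primes_gt0 l : all prime l -> 0 < \prod_(p <- l) p.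
Proof. by move=> /allP l_pr; rewrite big_seq prodn_cond_gt0 // => p /l_pr /prime_gt0. Qed.

Lemma dvdn_prod_primes p l :
  prime p -> all prime l -> (p %| \prod_(q <- l) q) = (p \in l).
Proof.
move=> p_pr; elim: l => [|q l IHl] /=; first by rewrite big_nil Euclid_dvd1.
by move=> /andP[q_pr l_pr]; rewrite big_cons Euclid_dvdM // IHl // dvdn_prime2.
Qed.

(** The factors by which the totient grows when the primes of [l] are multiplied onto a number whose
    prime divisors within [l] are those in [E]. Only the last occurrence of a prime outside [E]
    contributes [p.-1]. *)
Fixpoint totient_factors (E l : seq nat) : seq nat :=
  if l is p :: l' then
    (if (p \in E) || (p \in l') then p else p.-1) :: totient_factors E l'
  else [::].

Lemma totient_mul_primes m E l :
    0 < m -> all prime l -> {in l, forall p, (p %| m) = (p \in E)} ->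
  totient (m * \prod_(p <- l) p) = totient m * \prod_(p <- totient_factors E l) p.
Proof.
move=> m_gt0; elim: l => [|p l IHl] /=; first by rewrite !big_nil !muln1.
move=> /andP[p_pr l_pr] Em; rewrite !big_cons mulnCA totient_prime_mul //; last first.
  by rewrite muln_gt0 m_gt0 prod_primes_gt0.
rewrite Euclid_dvdM // dvdn_prod_primes // Em ?mem_head // IHl //; first exact: mulnCA.
by move=> q q_l; rewrite Em // inE q_l orbT.
Qed.

(** * Patterns and the case distinction *)

(* Products are computed in binary, [nat] being unary. *)
Definition prodN (l : seq nat) : N := foldr (fun p z => (N.of_nat p * z)%num) 1%num l.

Lemma prodNE l : prodN l = N.of_nat (\prod_(p <- l) p).
Proof. by elim: l => [|p l IHl]; rewrite ?big_nil // big_cons /= IHl Nat2N.inj_mul. Qed.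

(* Lists of primes, with multiplicity, stand for their products. *)
Record pattern := Pattern {
  new_primes : seq nat;  (* the set [T] *)
  num_n : seq nat;       (* [n / k = num_n / den] *)
  num_nk : seq nat;      (* [(n + k) / k = num_nk / den] *)
  den : seq nat }.

(** Truncated multiset difference: the part of [c] still missing from [D], or conversely what [D]
    has beyond [c]. *)
Definition msub (l l' : seq nat) : seq nat := foldr (fun p s => rem p s) l l'.

(* The state of the case distinction: [D] divides [k] and no [p] in [X] divides [k / D].
   Nothing is asked about a pattern that the state already excludes. *)
Definition undecided (D X : seq nat) (t : pattern) : seq nat :=
  let ab := num_n t ++ num_nk t in
  let c' := msub (den t) D in
  let excluded :=
    [|| has (mem X) c', has (mem D) (new_primes t)
      | has (fun p => [&& p \in X, p \notin D & p \notin new_primes t]) ab] in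
  if excluded then [::]
  else [seq p <- new_primes t ++ ab | (p \notin X) && (p \notin D)] ++ c'.

(** Once [D] is [c] times the product of [E], the quotient [k / c] is [k / D] times that product.
    Membership in [E] or [X] then settles which primes of [a * b] divide [k / c], so both totients
    are known multiples of [totient (k / c)]. *)
Definition applies (D X : seq nat) (t : pattern) : bool :=
  let E := msub D (den t) in
  [&& all prime (num_n t), all prime (num_nk t), all prime E,
      all (fun p => (p \in E) || (p \in X)) (num_n t ++ num_nk t),
      prodN D == prodN (den t ++ E),
      prodN (num_nk t) == (prodN (num_n t) + prodN (den t))%num
    & prodN (totient_factors E (num_nk t)) == prodN (2 :: totient_factors E (num_n t))].

(** As [n = k * a / c], distinct fractions [a / c] give distinct solutions; they are compared by
    cross-multiplication. *)
Definition distinct_ratio (t t' : pattern) : bool :=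
  prodN (num_n t ++ den t') != prodN (num_n t' ++ den t).

(** A branch succeeds with three distinct ratios, or when [D], a divisor of [k], exceeds the bound.
    Running out of fuel counts as failure, so the amount of fuel cannot affect soundness. *)
Fixpoint search (bound : seq nat) (fuel : nat) (D X : seq nat) (found ts : seq pattern) : bool :=
  if fuel isn't f.+1 then false
  else if 2 < size found then pairwise distinct_ratio found
  else if N.ltb (prodN bound) (prodN D) then true
  else if ts isn't t :: ts' then false
  else if undecided D X t is p :: _ then
    search bound f (p :: D) X found ts && search bound f D (p :: X) found ts
  else search bound f D X (if applies D X t then t :: found else found) ts'.

(** Three families [(a, b, c)] recur, for odd primes [p]: [((p-1)/2, p, (p+1)/2)] and
    [(p, 2(p-1), p-2)] with [T = {p}], and [(p-1, p, 1)] with [T = {2, p}]. *)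
Definition patterns : seq pattern :=
  [::
    Pattern [::] [::] [:: 2] [::];
    Pattern [:: 3] [::] [:: 3] [:: 2];
    Pattern [:: 2; 3] [:: 2] [:: 3] [::];
    Pattern [:: 3] [:: 3] [:: 2; 2] [::];
    Pattern [:: 2] [::] [:: 2; 2] [:: 3];
    Pattern [:: 5] [:: 2] [:: 5] [:: 3];
    Pattern [:: 2; 5] [:: 2; 2] [:: 5] [::];
    Pattern [:: 2; 3] [::] [:: 2; 3] [:: 5];
    Pattern [:: 5] [:: 5] [:: 2; 2; 2] [:: 3];
    Pattern [:: 2; 3] [:: 3] [:: 2; 2; 2] [:: 5];
    Pattern [:: 2; 7] [:: 2; 3] [:: 7] [::];
    Pattern [:: 7] [:: 7] [:: 2; 2; 3] [:: 5];
    Pattern [:: 11] [:: 5] [:: 11] [:: 2; 3];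
    Pattern [:: 2; 11] [:: 2; 5] [:: 11] [::];
    Pattern [:: 2; 7] [:: 3] [:: 2; 7] [:: 11];
    Pattern [:: 2; 5] [:: 5] [:: 2; 2; 2; 2] [:: 11];
    Pattern [:: 2; 5; 11] [:: 2; 11] [:: 5; 5] [:: 3];
    Pattern [:: 13] [:: 2; 3] [:: 13] [:: 7];
    Pattern [:: 2; 13] [:: 2; 2; 3] [:: 13] [::];
    Pattern [:: 13] [:: 13] [:: 2; 2; 2; 3] [:: 11];
    Pattern [:: 2; 13] [:: 13] [:: 2; 2; 2; 2; 3] [:: 5; 7];
    Pattern [:: 2; 17] [:: 2; 2; 2; 2] [:: 17] [::];
    Pattern [:: 2; 11] [:: 5] [:: 2; 11] [:: 17];
    Pattern [:: 17] [:: 17] [:: 2; 2; 2; 2; 2] [:: 3; 5];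
    Pattern [:: 2; 3; 5] [:: 3; 5] [:: 2; 2; 2; 2; 2] [:: 17];
    Pattern [:: 19] [:: 3; 3] [:: 19] [:: 2; 5];
    Pattern [:: 2; 19] [:: 2; 3; 3] [:: 19] [::];
    Pattern [:: 19] [:: 19] [:: 2; 2; 3; 3] [:: 17];
    Pattern [:: 2; 23] [:: 2; 11] [:: 23] [::];
    Pattern [:: 23] [:: 23] [:: 2; 2; 11] [:: 3; 7];
    Pattern [:: 2; 23] [:: 11] [:: 2; 23] [:: 5; 7];
    Pattern [:: 7; 23] [:: 2; 3; 11] [:: 7; 23] [:: 5; 19];
    Pattern [:: 29] [:: 2; 7] [:: 29] [:: 3; 5];
    Pattern [:: 2; 29] [:: 2; 2; 7] [:: 29] [::];
    Pattern [:: 7; 29] [:: 7; 7] [:: 3; 29] [:: 2; 19];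
    Pattern [:: 2; 31] [:: 2; 3; 5] [:: 31] [::];
    Pattern [:: 31] [:: 31] [:: 2; 2; 3; 5] [:: 29];
    Pattern [:: 37] [:: 2; 3; 3] [:: 37] [:: 19];
    Pattern [:: 2; 37] [:: 2; 2; 3; 3] [:: 37] [::];
    Pattern [:: 37] [:: 37] [:: 2; 2; 2; 3; 3] [:: 5; 7];
    Pattern [:: 41] [:: 2; 2; 5] [:: 41] [:: 3; 7];
    Pattern [:: 2; 41] [:: 2; 2; 2; 5] [:: 41] [::];
    Pattern [:: 41] [:: 41] [:: 2; 2; 2; 2; 5] [:: 3; 13];
    Pattern [:: 2; 41] [:: 41] [:: 2; 2; 2; 2; 2; 5] [:: 7; 17];
    Pattern [:: 43] [:: 3; 7] [:: 43] [:: 2; 11];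
    Pattern [:: 2; 43] [:: 2; 3; 7] [:: 43] [::];
    Pattern [:: 43] [:: 43] [:: 2; 2; 3; 7] [:: 41];
    Pattern [:: 7; 43] [:: 7; 7] [:: 2; 43] [:: 37];
    Pattern [:: 2; 47] [:: 2; 23] [:: 47] [::];
    Pattern [:: 2; 17] [:: 17] [:: 2; 2; 2; 2; 2; 2] [:: 47];
    Pattern [:: 11; 47] [:: 2; 5; 23] [:: 11; 47] [:: 7; 41];
    Pattern [:: 2; 53] [:: 2; 2; 13] [:: 53] [::];
    Pattern [:: 53] [:: 53] [:: 2; 2; 2; 13] [:: 3; 17];
    Pattern [:: 2; 53] [:: 53] [:: 2; 2; 2; 2; 13] [:: 5; 31];
    Pattern [:: 59] [:: 29] [:: 59] [:: 2; 3; 5];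
    Pattern [:: 2; 59] [:: 2; 29] [:: 59] [::];
    Pattern [:: 59] [:: 59] [:: 2; 2; 29] [:: 3; 19];
    Pattern [:: 2; 29; 59] [:: 2; 7; 59] [:: 29; 29] [:: 3; 5];
    Pattern [:: 29; 47; 59] [:: 29; 29; 47] [:: 2; 2; 2; 7; 23; 59] [:: 3; 5; 11; 13; 17];
    Pattern [:: 61] [:: 2; 3; 5] [:: 61] [:: 31];
    Pattern [:: 2; 61] [:: 2; 2; 3; 5] [:: 61] [::];
    Pattern [:: 61] [:: 61] [:: 2; 2; 2; 3; 5] [:: 59];
    Pattern [:: 2; 67] [:: 2; 3; 11] [:: 67] [::];
    Pattern [:: 67] [:: 67] [:: 2; 2; 3; 11] [:: 5; 13];
    Pattern [:: 11; 67] [:: 5; 67] [:: 2; 3; 11; 11] [:: 17; 23];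
    Pattern [:: 2; 71] [:: 2; 5; 7] [:: 71] [::];
    Pattern [:: 71] [:: 71] [:: 2; 2; 5; 7] [:: 3; 23];
    Pattern [:: 29; 31] [:: 29; 31] [:: 2; 2; 2; 2; 3; 5; 7] [:: 11; 71];
    Pattern [:: 7; 47; 71] [:: 3; 47; 71] [:: 2; 2; 5; 7; 7; 23] [:: 11; 17; 67];
    Pattern [:: 73] [:: 2; 2; 3; 3] [:: 73] [:: 37];
    Pattern [:: 2; 73] [:: 2; 2; 2; 3; 3] [:: 73] [::];
    Pattern [:: 2; 79] [:: 2; 3; 13] [:: 79] [::];
    Pattern [:: 79] [:: 79] [:: 2; 2; 3; 13] [:: 7; 11];
    Pattern [:: 7; 79] [:: 2; 3; 3; 13] [:: 7; 79] [:: 11; 29];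
    Pattern [:: 83] [:: 41] [:: 83] [:: 2; 3; 7];
    Pattern [:: 2; 83] [:: 2; 41] [:: 83] [::];
    Pattern [:: 7; 83] [:: 2; 3; 41] [:: 7; 83] [:: 5; 67];
    Pattern [:: 47; 83] [:: 2; 23; 41] [:: 47; 83] [:: 5; 13; 31];
    Pattern [:: 2; 89] [:: 2; 2; 2; 11] [:: 89] [::];
    Pattern [:: 89] [:: 89] [:: 2; 2; 2; 2; 11] [:: 3; 29];
    Pattern [:: 11; 89] [:: 2; 11; 11] [:: 5; 89] [:: 7; 29];
    Pattern [:: 2; 97] [:: 2; 2; 2; 2; 2; 3] [:: 97] [::];
    Pattern [:: 97] [:: 97] [:: 2; 2; 2; 2; 2; 2; 3] [:: 5; 19];
    Pattern [:: 101] [:: 2; 5; 5] [:: 101] [:: 3; 17];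
    Pattern [:: 2; 101] [:: 2; 2; 5; 5] [:: 101] [::];
    Pattern [:: 23; 47] [:: 23; 23] [:: 2; 11; 47] [:: 5; 101];
    Pattern [:: 47; 101] [:: 47; 101] [:: 2; 2; 2; 2; 5; 5; 23] [:: 61; 73];
    Pattern [:: 2; 103] [:: 2; 3; 17] [:: 103] [::];
    Pattern [:: 103] [:: 103] [:: 2; 2; 3; 17] [:: 101];
    Pattern [:: 17; 103] [:: 3; 17; 17] [:: 2; 2; 2; 2; 103] [:: 11; 71];
    Pattern [:: 2; 107] [:: 2; 53] [:: 107] [::];
    Pattern [:: 2; 37] [:: 37] [:: 2; 2; 2; 2; 3; 3] [:: 107];
    Pattern [:: 107] [:: 107] [:: 2; 2; 53] [:: 3; 5; 7];
    Pattern [:: 47; 107] [:: 47; 53] [:: 2; 23; 107] [:: 11; 13; 17];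
    Pattern [:: 53; 107] [:: 53; 53] [:: 2; 2; 13; 107] [:: 5; 19; 29];
    Pattern [:: 7; 71; 107] [:: 5; 7; 7; 107] [:: 2; 2; 3; 53; 71] [:: 13; 31; 47];
    Pattern [:: 109] [:: 2; 3; 3; 3] [:: 109] [:: 5; 11];
    Pattern [:: 2; 109] [:: 2; 2; 3; 3; 3] [:: 109] [::];
    Pattern [:: 109] [:: 109] [:: 2; 2; 2; 3; 3; 3] [:: 107];
    Pattern [:: 11; 23] [:: 11; 11] [:: 2; 5; 23] [:: 109];
    Pattern [:: 113] [:: 2; 2; 2; 7] [:: 113] [:: 3; 19];
    Pattern [:: 2; 113] [:: 2; 2; 2; 2; 7] [:: 113] [::];
    Pattern [:: 7; 113] [:: 2; 2; 7; 7] [:: 3; 113] [:: 11; 13];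
    Pattern [:: 2; 127] [:: 2; 3; 3; 7] [:: 127] [::];
    Pattern [:: 23; 127] [:: 11; 127] [:: 2; 3; 3; 7; 23] [:: 19; 79];
    Pattern [:: 29; 127] [:: 2; 2; 3; 3; 7; 7] [:: 29; 127] [:: 19; 101];
    Pattern [:: 31; 127] [:: 2; 3; 3; 3; 5; 7] [:: 31; 127] [:: 23; 89];
    Pattern [:: 47; 127] [:: 3; 3; 7; 47] [:: 2; 23; 127] [:: 43; 67];
    Pattern [:: 83; 127] [:: 3; 3; 7; 83] [:: 2; 41; 127] [:: 5; 17; 61];
    Pattern [:: 2; 131] [:: 2; 5; 13] [:: 131] [::];
    Pattern [:: 131] [:: 131] [:: 2; 2; 5; 13] [:: 3; 43];
    Pattern [:: 137] [:: 2; 2; 17] [:: 137] [:: 3; 23];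
    Pattern [:: 2; 137] [:: 2; 2; 2; 17] [:: 137] [::];
    Pattern [:: 17; 137] [:: 17; 17] [:: 2; 2; 137] [:: 7; 37];
    Pattern [:: 139] [:: 3; 23] [:: 139] [:: 2; 5; 7];
    Pattern [:: 2; 139] [:: 2; 3; 23] [:: 139] [::];
    Pattern [:: 139] [:: 139] [:: 2; 2; 3; 23] [:: 137];
    Pattern [:: 23; 139] [:: 11; 139] [:: 2; 3; 23; 23] [:: 5; 7; 47];
    Pattern [:: 71; 137] [:: 71; 137] [:: 2; 2; 2; 2; 2; 5; 7; 17] [:: 67; 139];
    Pattern [:: 2; 149] [:: 2; 2; 37] [:: 149] [::];
    Pattern [:: 7; 149] [:: 3; 149] [:: 2; 2; 7; 37] [:: 19; 31];
    Pattern [:: 11; 149] [:: 2; 2; 5; 37] [:: 11; 149] [:: 29; 31];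
    Pattern [:: 47; 149] [:: 2; 2; 23; 37] [:: 47; 149] [:: 59; 61];
    Pattern [:: 101; 149] [:: 37; 101] [:: 2; 5; 5; 149] [:: 47; 79];
    Pattern [:: 71; 149] [:: 5; 7; 149] [:: 2; 2; 37; 71] [:: 67; 79];
    Pattern [:: 137; 149] [:: 2; 2; 2; 2; 17; 37] [:: 137; 149] [:: 79; 131];
    Pattern [:: 2; 151] [:: 2; 3; 5; 5] [:: 151] [::];
    Pattern [:: 29; 151] [:: 2; 2; 3; 5; 5; 7] [:: 29; 151] [:: 43; 53];
    Pattern [:: 31; 151] [:: 2; 3; 3; 5; 5; 5] [:: 31; 151] [:: 11; 13; 17];
    Pattern [:: 83; 151] [:: 3; 5; 5; 83] [:: 2; 41; 151] [:: 47; 131];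
    Pattern [:: 127; 151] [:: 2; 3; 3; 3; 5; 5; 7] [:: 127; 151] [:: 71; 137];
    Pattern [:: 2; 157] [:: 2; 2; 3; 13] [:: 157] [::];
    Pattern [:: 157] [:: 157] [:: 2; 2; 2; 3; 13] [:: 5; 31];
    Pattern [:: 163] [:: 3; 3; 3; 3] [:: 163] [:: 2; 41];
    Pattern [:: 167] [:: 167] [:: 2; 2; 83] [:: 3; 5; 11]
  ].

(** * Soundness of the case distinction *)

Definition solves (k n : nat) : Prop := totient (n + k) = 2 * totient n.

Definition realizes (k : nat) (t : pattern) (n : nat) : Prop :=
  [/\ 0 < n, solves k n & n * \prod_(p <- den t) p = k * \prod_(p <- num_n t) p].

Lemma applies_realizes D X t m :
    0 < m -> {in X, forall p, ~~ (p %| m)} -> applies D X t ->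
  exists n, realizes (m * \prod_(p <- D) p) t n.
Proof.
move=> m_gt0 Xm; case/and5P; set E := msub _ _ => a_pr b_pr E_pr.
rewrite all_cat => /andP[/allP aEX /allP bEX].
rewrite !prodNE -Nat2N.inj_add plusE big_cat big_cons /=.
case/and3P=> /eqP/Nat2N.inj-> /eqP/Nat2N.inj b_eq /eqP/Nat2N.inj w_eq.
set a := \prod_(p <- num_n t) p in b_eq *; set c := \prod_(p <- den t) p in b_eq *.
(* Here [m] is [k / D] and [M] is [k / c]; the solution is [n = M * a], with [n + k = M * b]. *)
pose M := m * \prod_(p <- E) p.
have M_gt0 : 0 < M by rewrite muln_gt0 m_gt0 prod_primes_gt0.
have dvdM l : all prime l -> {in l, forall p, (p \in E) || (p \in X)} ->
    {in l, forall p, (p %| M) = (p \in E)}.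
  move=> /allP l_pr lEX p p_l; rewrite Euclid_dvdM ?l_pr // dvdn_prod_primes ?l_pr //.
  by case/orP: (lEX p p_l) => [->|/Xm/negbTE->]; rewrite ?orbT.
exists (M * a); split; first by rewrite muln_gt0 M_gt0 prod_primes_gt0.
- rewrite /solves.
  have -> : M * a + m * (c * \prod_(p <- E) p) = M * \prod_(p <- num_nk t) p.
    by rewrite b_eq mulnDr (mulnC c) mulnA.
  rewrite (totient_mul_primes M E) // ?w_eq; last exact: dvdM.
  rewrite (totient_mul_primes M E) //; last exact: dvdM.
  by rewrite mulnCA.
- by rewrite (mulnC c) !mulnA -!mulnA (mulnC a).
Qed.

Lemma realizes_inj k s t n n' :
    0 < k -> distinct_ratio s t -> realizes k s n -> realizes k t n' -> n <> n'.
Proof.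
move=> k_gt0 /eqP st [n_gt0 _ s_n] [_ _ t_n'] eq_nn'; apply: st.
rewrite !prodNE !big_cat /=; congr N.of_nat.
apply/eqP; rewrite -(eqn_pmul2l k_gt0) !mulnA -s_n -t_n' eq_nn'; apply/eqP.
exact: mulnAC.
Qed.

(** Induction on [fuel] with [k] fixed; the invariant is that [m = k / D], that no prime in [X]
    divides [m], and that every pattern found yields a solution. *)
Lemma search_sound k bound fuel D X found ts m :
    0 < k <= \prod_(p <- bound) p -> k = m * \prod_(p <- D) p ->
    {in X, forall p, ~~ (p %| m)} ->
    (forall t, List.In t found -> exists n, realizes k t n) ->
    search bound fuel D X found ts ->
  exists n1 n2 n3 : nat,
    [/\ [/\ 0 < n1, 0 < n2 & 0 < n3], [/\ n1 <> n2, n1 <> n3 & n2 <> n3],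
        solves k n1, solves k n2 & solves k n3].
Proof.
move=> /andP[k_gt0 k_le].
elim: fuel D X found ts m => //= f IHf D X found ts m kE Xm found_k.
case: ifP => [|_].
  case: found found_k => [|t1 [|t2 [|t3 found]]] // found_k _ /=.
  case/and3P => /and3P[d12 d13 _] /andP[d23 _] _.
  have [n1 n1P] := found_k t1 (or_introl erefl).
  have [n2 n2P] := found_k t2 (or_intror (or_introl erefl)).
  have [n3 n3P] := found_k t3 (or_intror (or_intror (or_introl erefl))).
  exists n1, n2, n3.
  have neq12 := realizes_inj _ _ _ _ _ k_gt0 d12 n1P n2P.
  have neq13 := realizes_inj _ _ _ _ _ k_gt0 d13 n1P n3P.
  have neq23 := realizes_inj _ _ _ _ _ k_gt0 d23 n2P n3P.
  by case: n1P n2P n3P => [? ? _] [? ? _] [? ? _].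
have m_gt0 : 0 < m by move: k_gt0; rewrite kE muln_gt0 => /andP[].
case: ifP => [|_].
  rewrite !prodNE => /N.ltb_lt bound_lt.
  suff: \prod_(p <- D) p <= \prod_(p <- bound) p by lia.
  by apply: leq_trans k_le; rewrite kE leq_pmull.
case: ts => [//|t ts]; case: (undecided _ _ _) => [|p _].
  apply: (IHf _ _ _ _ m) => // t'; case: ifP => [t_applies|_]; last exact: found_k.
  by case=> [<-|/found_k//]; rewrite kE; apply: applies_realizes t_applies.
(* If [p] divides [m], it moves into [D] and [m %/ p] takes over; [X] stays valid because [m %/ p]
   divides [m]. *)
case/andP => search_p search_np; have [p_m|np_m] := boolP (p %| m).
  apply: (IHf _ _ _ _ (m %/ p)) search_p => //.
    by rewrite big_cons mulnA divnK.
  by move=> q /Xm; apply: contra => /dvdn_trans; apply; rewrite dvdn_div.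
apply: (IHf _ _ _ _ m) search_np => // q.
by rewrite inE => /predU1P[->//|]; exact: Xm.
Qed.

Theorem theorem1 (k : nat) (hk0 : 0 < k) (hk : k <= 4 * 10 ^ 58) :
  exists n1 n2 n3 : nat,
    [/\ [/\ 0 < n1, 0 < n2 & 0 < n3],
        [/\ n1 <> n2, n1 <> n3 & n2 <> n3],
        totient (n1 + k) = 2 * totient n1,
        totient (n2 + k) = 2 * totient n2
      & totient (n3 + k) = 2 * totient n3].
Proof.
(* The list [4 :: nseq 58 10] encodes [4 * 10 ^ 58], so that [prodN] evaluates it in binary; fuel
   200 covers the depth of every branch. *)
have checked : search (4 :: nseq 58 10) 200 [::] [::] [::] patterns by vm_compute.
have k_bounds : 0 < k <= \prod_(p <- 4 :: nseq 58 10) p.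
  by apply/andP; split; [exact: hk0 | rewrite big_cons big_nseq iter_muln_1; exact: hk].
(* Making the bound opaque keeps its huge unary product from being evaluated. *)
move: k_bounds checked => {hk0 hk}; move: (4 :: _) => bound k_bounds.
by apply: (search_sound k bound _ _ _ _ _ k) => //; rewrite big_nil muln1.
Qed.
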